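(* For every choice of $q=q(n)\ge0$, $$L(n,q)\lesssim \frac{192\,n\,2^n}{\log_2 n},$$ i.e. $L(n,q(n))\le (1+o(1))\,\dfrac{192\,n\,2^n}{\log_2 n}$ as $n\to\infty$.
   Context: For $m\ge1$, a $k$-CNOT gate on $m$ lines with control lines $i_1,\dots,i_k$ and target line $j\notin\{i_1,\dots,i_k\}$ is the map $\mathbb Z_2^m\to\mathbb Z_2^m$ replacing $x_j$ by $x_j\oplus(x_{i_1}\wedge\dots\wedge x_{i_k})$ and leaving other coordinates unchanged; NOT, CNOT, 2-CNOT are the cases $k=0,1,2$. A reversible circuit on $m$ lines is a finite sequence of such gates, computing their composition $g$; its complexity is its number of gates. With $\phi_{n,n+q}(\langle x_1,\dots,x_n\rangle)=\langle x_1,\dots,x_n,0,\dots,0\rangle\in\mathbb Z_2^{n+q}$ and $\psi_{n+q,n}(\langle x_1,\dots,x_{n+q}\rangle)=\langle x_1,\dots,x_n\rangle$, a circuit on $n+q$ lines implements $f\colon\mathbb Z_2^n\to\mathbb Z_2^n$ with $q$ additional inputs if $\psi_{n+q,n}(g(\phi_{n,n+q}(\vec x)))=f(\vec x)$ for all $\vec x$. $F(n,q)$ is the set of maps $\mathbb Z_2^n\to\mathbb Z_2^n$ implementable this way. The Shannon function $L(n,q)$ is the maximum, over all $f\in F(n,q)$, of the minimum complexity of a reversible circuit of NOT, CNOT, 2-CNOT gates implementing $f$ with $q$ additional inputs. *)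

(* Defs.v *)
From mathcomp Require Import all_boot.
From Stdlib Require Import Reals ClassicalEpsilon.
Set Implicit Arguments. Unset Strict Implicit. Unset Printing Implicit Defensive.

Definition vec (m : nat) := {ffun 'I_m -> bool}.

(* A gate on m lines: (set of control lines, target line). *)
Definition gate (m : nat) : finType := ({set 'I_m} * 'I_m)%type.

(* Allowed gates: NOT, CNOT, 2-CNOT, i.e. k-CNOT with k <= 2, target not a control. *)
Definition valid_gate m (g : gate m) : bool := (g.2 \notin g.1) && (#|g.1| <= 2).

(* x_j := x_j xor (AND of the controls); the empty conjunction is true (NOT gate). *)
Definition apply_gate m (g : gate m) (x : vec m) : vec m :=
  [ffun i => if i == g.2 then x i (+) [forall j in g.1, x j] else x i].

Definition run_circuit m (c : seq (gate m)) (x : vec m) : vec m :=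
  foldl (fun y g => apply_gate g y) x c.

Definition phi n q (x : vec n) : vec (n + q) :=
  [ffun i : 'I_(n + q) => match fintype.split i with inl j => x j | inr _ => false end].

Definition psi n q (y : vec (n + q)) : vec n := [ffun j : 'I_n => y (lshift q j)].

Definition implements n q (c : seq (gate (n + q))) (f : vec n -> vec n) : bool :=
  all (@valid_gate (n + q)) c && [forall x : vec n, @psi n q (run_circuit c (@phi n q x)) == f x].

Definition implementable_with n q (f : vec n -> vec n) (k : nat) : bool :=
  [exists c : k.-tuple (gate (n + q)), @implements n q (tval c) f].

(* minimal complexity of f (0 if f is not in F(n,q); such f do not affect L) *)
Definition complexity n q (f : vec n -> vec n) : nat :=
  match excluded_middle_informative (exists k, @implementable_with n q f k) with
  | left H => ex_minn H
  | right _ => 0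
  end.

Definition L_shannon (n q : nat) : nat :=
  \max_(f : {ffun vec n -> vec n}) @complexity n q f.

Definition log2 (x : R) : R := (ln x / ln 2)%R.

Definition shannon_bound (n : nat) : R := (192 * INR n * 2 ^ n / log2 (INR n))%R.

(* Main.v *)
(* Let m = n + min(q, n); the task is to realise a given permutation s of the
   2^m vectors on the 2^n inputs (x, 0), at cost 162 n 2^n / log2 n for large n.
   One corrects the inputs K = 2^k at a time, with 8^K <= n < 64^K: as long as
   4K inputs are misplaced, K of them can be chosen so that their K current
   and K wanted positions are 2K distinct vectors, and these K swaps are done
   by one block.  Read as an array with 2K rows, the 2K vectors have at most 4^K
   distinct columns, so m CNOT gates clear all lines but 4^K, and then o(m)
   gates bring the vectors to a subcube of dimension k + 1 in which the swap is
   a single gate with m - k - 1 controls.  That gate costs 8m, using any idle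
   line as a dirty ancilla, so a block costs (12 + o(1)) m <= (24 + o(1)) n.
   The remaining inputs are handled by pairs of transpositions.  A last unpaired
   transposition is either paired with a swap outside the relevant inputs (q > 0),
   or excluded because circuits on more than three lines are even (q = 0). *)

Require Import Defs.
From Stdlib Require Import Reals Lra ClassicalEpsilon.
From mathcomp Require Import all_boot all_fingroup zify.

Set Implicit Arguments. Unset Strict Implicit. Unset Printing Implicit Defensive.
(* MathComp rebinds the key [R] to [ring_scope]. *)
Delimit Scope R_scope with R.

(** * Gates and their circuits *)

Definition all_on m (C : {set 'I_m}) (x : vec m) := [forall j in C, x j].

Lemma apply_gateE m (C : {set 'I_m}) t (x : vec m) i :
  apply_gate (C, t) x i = if i == t then x i (+) all_on C x else x i.
Proof. by rewrite ffunE. Qed.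

Lemma eq_all_on m (C : {set 'I_m}) (x y : vec m) :
  {in C, x =1 y} -> all_on C x = all_on C y.
Proof.
move=> xy; apply: eq_forallb => j.
by case: (boolP (j \in C)) => //= jC; rewrite xy.
Qed.

Lemma all_onP m (C : {set 'I_m}) (x : vec m) :
  reflect {in C, forall j, x j} (all_on C x).
Proof. exact: 'forall_implyP. Qed.

Lemma all_onU m (C D : {set 'I_m}) (x : vec m) :
  all_on (C :|: D) x = all_on C x && all_on D x.
Proof.
apply/all_onP/andP => [CD | [/all_onP xC /all_onP xD] j].
  by split; apply/all_onP => j jC; apply: CD; rewrite inE jC ?orbT.
by rewrite inE => /orP[/xC | /xD].
Qed.

Lemma all_on1 m c (x : vec m) : all_on [set c] x = x c.
Proof.
apply/all_onP/idP => [|xc j]; first by apply; rewrite inE.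
by rewrite inE => /eqP->.
Qed.

Lemma all_on0 m (x : vec m) : all_on set0 x.
Proof. by apply/all_onP => j; rewrite inE. Qed.

Lemma apply_gateK m (g : gate m) : g.2 \notin g.1 -> involutive (apply_gate g).
Proof.
case: g => C t /= tC x; apply/ffunP => i; rewrite !apply_gateE.
have -> : all_on C (apply_gate (C, t) x) = all_on C x.
  apply: eq_all_on => j jC; rewrite apply_gateE; case: eqP => // jt.
  by rewrite -jt jC in tC.
by case: eqP => // _; rewrite addbK.
Qed.

Lemma run_circuit_cat m (c1 c2 : seq (gate m)) x :
  run_circuit (c1 ++ c2) x = run_circuit c2 (run_circuit c1 x).
Proof. exact: foldl_cat. Qed.

Lemma run_circuit_revK m (c : seq (gate m)) :
  all (@valid_gate m) c -> cancel (run_circuit c) (run_circuit (rev c)).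
Proof.
elim: c => [|g c IH] //= /andP[/andP[gv _] cv] x.
by rewrite rev_cons -cats1 run_circuit_cat IH //= apply_gateK.
Qed.

(** * Maps computed by at most [k] gates *)

Definition cost_le m k (f : vec m -> vec m) :=
  exists c : seq (gate m),
    [/\ all (@valid_gate m) c, size c <= k & run_circuit c =1 f].

Section Cost.
Variable m : nat.
Implicit Types (f g h : vec m -> vec m) (C D : {set 'I_m}).

Lemma cost_le_comp k1 k2 f g :
  cost_le k1 f -> cost_le k2 g -> cost_le (k1 + k2) (g \o f).
Proof.
move=> [c1 [v1 s1 r1]] [c2 [v2 s2 r2]]; exists (c1 ++ c2); split.
- by rewrite all_cat v1.
- by rewrite size_cat leq_add.
- by move=> x; rewrite run_circuit_cat r1 r2.
Qed.

Lemma cost_le_eq k f g : f =1 g -> cost_le k f -> cost_le k g.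
Proof. by move=> fg [c [v s r]]; exists c; split=> // x; rewrite r. Qed.

Lemma cost_leW k1 k2 f : k1 <= k2 -> cost_le k1 f -> cost_le k2 f.
Proof.
by move=> k12 [c [v s r]]; exists c; split=> //; apply: leq_trans k12.
Qed.

Lemma cost_le_id : cost_le 0 (@id (vec m)).
Proof. by exists [::]. Qed.

Lemma cost_le_inv k f :
  cost_le k f -> exists g, [/\ cost_le k g, cancel f g & cancel g f].
Proof.
move=> [c [v s r]]; have vr : all (@valid_gate m) (rev c) by rewrite all_rev.
exists (run_circuit (rev c)); split.
- by exists (rev c); rewrite size_rev.
- by move=> x; rewrite -r run_circuit_revK.
- by move=> x; rewrite -r -{1}[c]revK run_circuit_revK.
Qed.

Lemma cost_le_inj k f : cost_le k f -> injective f.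
Proof. by move=> /cost_le_inv[g [_ fK _]]; apply: can_inj fK. Qed.

Lemma cost_le_gate (g : gate m) : valid_gate g -> cost_le 1 (apply_gate g).
Proof. by move=> v; exists [:: g]; rewrite /= v. Qed.

Definition layer D (G : 'I_m -> {set 'I_m}) (x : vec m) : vec m :=
  [ffun i => if i \in D then x i (+) all_on (G i) x else x i].

Lemma cost_le_layer D (G : 'I_m -> {set 'I_m}) :
  {in D, forall i, #|G i| <= 2} -> {in D &, forall i j, j \notin G i} ->
  cost_le #|D| (layer D G).
Proof.
move=> G2 GD; exists [seq (G i, i) | i <- enum D]; split.
- apply/allP => g /mapP[i]; rewrite mem_enum => iD ->.
  by rewrite /valid_gate /= G2 // GD.
- by rewrite size_map cardE.
suff run l x : uniq l -> {subset l <= D} ->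
    run_circuit [seq (G i, i) | i <- l] x
    = [ffun i => if i \in l then x i (+) all_on (G i) x else x i].
  move=> x; rewrite run ?enum_uniq //; last by move=> i; rewrite mem_enum.
  by apply/ffunP => i; rewrite !ffunE mem_enum.
elim: l x => [|d l IH] x; first by move=> _ _; apply/ffunP => i; rewrite ffunE.
rewrite /= => /andP[dl lu] Ds.
have ls : {subset l <= D} by move=> i il; apply: Ds; rewrite inE il orbT.
have dD : d \in D by apply: Ds; rewrite inE eqxx.
rewrite IH //; apply/ffunP => i; rewrite !ffunE /= inE.
case: (eqVneq i d) => [->|nid] /=; first by rewrite (negPf dl).
case: ifP => // il; congr (_ (+) _); apply: eq_all_on => j jG.
rewrite ffunE /=; case: eqP => // jd.
by move: (GD i d (ls _ il) dD); rewrite -jd jG.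
Qed.

End Cost.

(** * Gates with many controls, built with dirty ancillas *)

Section Ladder.
Variable m : nat.
Implicit Types (l : seq ('I_m * 'I_m)) (x : vec m).

(* Each [d_j], in an unknown state, gets XORed with [c_1 /\ ... /\ c_j]; the head
   of the list is the pair of largest index.  Running the ladder and then its
   tail restores all the [d_j] but the last one. *)
Fixpoint ladder l : seq (gate m) :=
  match l with
  | [::] => [::]
  | (c, d) :: l' =>
    match l' with
    | [::] => [:: ([set c], d)]
    | (_, d') :: _ => ([set c; d'], d) :: rcons (ladder l') ([set c; d'], d)
    end
  end.

Fixpoint ladder_xor l x i : bool :=
  match l with
  | [::] => false
  | (_, d) :: l' =>
    if i == d then all (fun p => x p.1) l else ladder_xor l' x i
  end.

Definition ladder_ok l :=
  uniq [seq p.2 | p <- l] && all (fun p => p.1 \notin [seq p.2 | p <- l]) l.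

Lemma ladder_ok_behead p l : ladder_ok (p :: l) -> ladder_ok l.
Proof.
case/andP=> /= /andP[_ u] /andP[_ a]; rewrite /ladder_ok u /=.
by apply: sub_all a => q; rewrite inE negb_or => /andP[].
Qed.

Lemma ladder_xor_notin l x i : i \notin [seq p.2 | p <- l] -> ladder_xor l x i = false.
Proof.
elim: l => [|[c d] l IH] //=; rewrite inE negb_or => /andP[/negPf-> ]; exact: IH.
Qed.

Lemma eq_ladder_xor l (x y : vec m) :
  {in [seq p.1 | p <- l], x =1 y} -> ladder_xor l x =1 ladder_xor l y.
Proof.
elim: l => [|[c d] l IH] //= xy i.
have xyl : {in [seq p.1 | p <- l], x =1 y}.
  by move=> j jl; apply: xy; rewrite inE jl orbT.
rewrite IH // xy ?inE ?eqxx //; case: ifP => // _; congr (_ && _).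
by apply: eq_in_all => p pl; apply: xyl; apply: map_f.
Qed.

Lemma ladder_valid l : ladder_ok l -> all (@valid_gate m) (ladder l).
Proof.
elim: l => [|[c d] [|[c' d'] l] IH] //.
  rewrite /ladder_ok /valid_gate /= !inE cards1 !andbT eq_sym; exact: id.
move=> ok; have := IH (ladder_ok_behead ok); move: ok.
rewrite /ladder_ok => /andP[/= /andP[]]; rewrite !inE negb_or => /andP[dd' _] _.
move=> /andP[]; rewrite !negb_or => /andP[cd _] _ v.
have vg : valid_gate (([set c; d'], d) : gate m).
  by rewrite /valid_gate /= !inE negb_or eq_sym cd dd' cards2; case: eqP.
by rewrite vg all_rcons vg; exact: v.
Qed.

Lemma size_ladder l : size (ladder l) <= (size l).*2.
Proof.
elim: l => [|[c d] [|[c' d'] l] IH] //=.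
by rewrite size_rcons doubleS !ltnS; exact: IH.
Qed.

(** The gate [g] on [c] and [d'] is applied before and after the shorter ladder. Line [d] thus
    receives [c /\ d'] for the old and the new value of [d']; the unknown old value cancels, and [c]
    times the conjunction already added to [d'] remains. *)
Lemma run_ladder l x : ladder_ok l ->
  run_circuit (ladder l) x = [ffun i => x i (+) ladder_xor l x i].
Proof.
elim: l x => [|[c d] l IH] x ok.
  by apply/ffunP => i; rewrite ffunE addbF.
have okl := ladder_ok_behead ok.
case: l => [|[c' d'] l] in IH ok okl *.
  apply/ffunP => i; rewrite [RHS]ffunE /= apply_gateE all_on1 andbT.
  by case: eqP; rewrite ?addbF.
set l1 := _ :: l in IH okl ok *.
set g : gate m := ([set c; d'], d).
have -> : ladder ((c, d) :: l1) = g :: rcons (ladder l1) g by [].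
move: ok; rewrite /ladder_ok => /andP[/= /andP[dl _] /andP[]].
rewrite inE negb_or => /andP[cd cl] al.
have {}al p : p \in l1 -> p.1 != d.
  by move/(allP (al : all _ l1)); rewrite inE negb_or => /andP[].
have gE (y : vec m) k : apply_gate g y k = if k == d then y k (+) (y c && y d') else y k.
  by rewrite apply_gateE all_onU !all_on1.
rewrite -cats1 run_circuit_cat /= IH //.
have -> : [ffun i => apply_gate g x i (+) ladder_xor l1 (apply_gate g x) i]
        = [ffun i => apply_gate g x i (+) ladder_xor l1 x i] :> vec m.
  apply/ffunP => i; rewrite [LHS]ffunE [RHS]ffunE; congr (_ (+) _).
  by apply: eq_ladder_xor => j /mapP[p /al/negPf pd ->]; rewrite gE pd.
set y := finfun _.
have yE k : y k = apply_gate g x k (+) ladder_xor l1 x k by rewrite [LHS]ffunE.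
apply/ffunP => i; rewrite gE [RHS]ffunE !yE !gE (negPf cd) (@ladder_xor_notin l1 x c cl).
have /andP[d'd dl'] : (d' != d) && (d \notin [seq p.2 | p <- l]).
  by move: dl; rewrite inE negb_or eq_sym.
rewrite (negPf d'd) addbF.
have -> : ladder_xor l1 x d' = all (fun p => x p.1) l1 by rewrite /= eqxx.
rewrite -/(ladder_xor l1 x i).
case: eqP => [->|//].
rewrite (@ladder_xor_notin l1) ?inE ?negb_or 1?eq_sym ?d'd // addbF -addbA.
by rewrite /=; case: (x c) => //=; case: (x d'); case: (x c' && _).
Qed.

(** Half of the lines suffice as dirty ancillas: [t] is put at the head of a ladder, and [#|C|.-1]
    lines outside [t |: C] serve below it. The full ladder followed by its tail cancels everywhere
    except on [t]. The successor in the cost accounts for an empty [C], where the gate is one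
    NOT. *)
Lemma cost_le_small_gate (C : {set 'I_m}) t :
  t \notin C -> 2 * #|C| <= m -> cost_le (4 * #|C|).+1 (apply_gate (C, t)).
Proof.
move=> tC Cm; have [C0|Cn0] := eqVneq C set0.
  apply: (@cost_leW _ 1) => //; apply: cost_le_gate.
  by rewrite /valid_gate /= tC C0 cards0.
have Cpos : 0 < #|C| by rewrite card_gt0.
set E := ~: (t |: C).
have cE : #|C|.-1 <= size (enum E).
  by rewrite -cardE; have := cardsC (t |: C); rewrite cardsU1 tC card_ord -/E; lia.
set ds := t :: take #|C|.-1 (enum E).
have sds : size ds = #|C| by rewrite /= size_takel // prednK.
set l := zip (enum C) ds.
have l2 : [seq p.2 | p <- l] = ds by rewrite -/(unzip2 _) unzip2_zip // -cardE sds.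
have l1 : [seq p.1 | p <- l] = enum C by rewrite -/(unzip1 _) unzip1_zip // -cardE sds.
have dsC d : d \in ds -> d \notin C.
  rewrite inE => /orP[/eqP->//|/mem_take]; rewrite mem_enum !inE negb_or.
  by case/andP.
have ok : ladder_ok l.
  rewrite /ladder_ok l2 /= take_uniq ?enum_uniq // andbT; apply/andP; split.
    by apply/negP => /mem_take; rewrite mem_enum !inE eqxx.
  apply/allP => p pl; apply/negP => /dsC /negP; apply.
  by rewrite -mem_enum -l1 map_f.
have sl : size l = #|C| by rewrite size_zip sds -cardE minnn.
exists (ladder l ++ ladder (behead l)).
case: (l) ok sl l1 l2 => [|[c d] l'] ok sl l1 l2; first by rewrite -sl in Cpos.
have okl := ladder_ok_behead ok.
have dt : d = t by case: (l2).
split.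
- by rewrite all_cat !ladder_valid.
- have := size_ladder ((c, d) :: l'); have := size_ladder l'.
  by rewrite size_cat /behead -sl; set k := size (ladder (_ :: _)) => /=; lia.
move=> x; rewrite run_circuit_cat /behead !run_ladder //; apply/ffunP => i.
rewrite apply_gateE !ffunE -dt.
have -> : ladder_xor l' [ffun i => x i (+) ladder_xor ((c, d) :: l') x i] i = ladder_xor l' x i.
  apply: eq_ladder_xor => j jl; rewrite ffunE ladder_xor_notin ?addbF //.
  rewrite l2; apply/negP => /dsC /negP; apply; rewrite -mem_enum -l1 /=.
  by rewrite inE jl orbT.
have aC : all (fun p => x p.1) ((c, d) :: l') = all_on C x.
  rewrite -[LHS](all_map fst x) l1; apply/allP/all_onP => H j.
    by rewrite -mem_enum; apply: H.
  by rewrite mem_enum; apply: H.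
rewrite /ladder_xor -/ladder_xor aC.
case: eqP => [->|_]; last by rewrite addbK.
rewrite ladder_xor_notin ?addbF //.
by case/andP: ok => /= /andP[].
Qed.

End Ladder.

(** * Swapping a block of pairs of vectors *)

Section Group.
Variable m : nat.
Implicit Types (C D P T : {set 'I_m}) (t e : 'I_m).

Lemma split_set C k : exists D E,
  [/\ C = D :|: E, #|D| <= minn k #|C| & #|E| <= #|C| - k].
Proof.
exists [set i in take k (enum C)], [set i in drop k (enum C)]; split.
- apply/setP => i; rewrite !inE -mem_cat cat_take_drop.
  by rewrite mem_enum.
- by rewrite cardsE (leq_trans (card_size _)) // size_take_min -cardE.
- by rewrite cardsE (leq_trans (card_size _)) // size_drop -cardE.
Qed.

(* The idle line [e] is borrowed in an unknown state to split the control set. *)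
Lemma cost_le_big_gate C t e :
  t \notin C -> e \notin C -> e != t -> cost_le (8 * m) (apply_gate (C, t)).
Proof.
move=> tC eC et.
have Cm : #|C| + 2 <= m.
  have := subset_leq_card (subsetT (e |: (t |: C))).
  by rewrite !cardsU1 !inE negb_or et eC tC cardsT card_ord addn2.
have [C1 [C2 [CE c1 c2]]] := split_set C m./2.
move: tC eC; rewrite CE !inE !negb_or => /andP[tC1 tC2] /andP[eC1 eC2].
have tC2e : t \notin e |: C2 by rewrite !inE negb_or eq_sym et.
have cC2e : #|e |: C2| = #|C2|.+1 by rewrite cardsU1 eC2.
have m2 := odd_double_half m.
have odd1 : odd m <= 1 by case: odd.
have c1m : 2 * #|C1| <= m by lia.
have c2m : 2 * #|e |: C2| <= m by lia.
have gm : (4 * #|e |: C2|).+1 + (4 * #|C1|).+1 <= 4 * m.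
  by have : #|C1| + #|C2| <= #|C|; rewrite ?cC2e; lia.
have g1 := cost_le_small_gate eC1 c1m.
have g2 := cost_le_small_gate tC2e c2m.
(* Line [t] receives [e /\ C2] and then [(e (+) C1) /\ C2], whose sum is [C1 /\ C2]; the second gate
   on [e] restores it. *)
have g := cost_le_comp (cost_le_comp g2 g1) (cost_le_comp g2 g1).
apply: (cost_le_eq _ (cost_leW (k2 := 8 * m) _ g)); last first.
  by apply: leq_trans (leq_add gm gm) _; lia.
move=> x; rewrite /=.
have E1 (y : vec m) i : apply_gate (C1, e) y i = if i == e then y i (+) all_on C1 y else y i.
  by rewrite apply_gateE.
have E2 (y : vec m) i :
    apply_gate (e |: C2, t) y i = if i == t then y i (+) (y e && all_on C2 y) else y i.
  by rewrite apply_gateE all_onU all_on1.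
set y1 := apply_gate (_ |: _, _) x; set y2 := apply_gate (C1, e) y1.
set y3 := apply_gate (_ |: _, _) y2.
have a1 : all_on C1 y1 = all_on C1 x.
  apply: eq_all_on => j jC; rewrite E2; case: eqP => // jt.
  by rewrite -jt jC in tC1.
have a2 : all_on C2 y2 = all_on C2 x.
  apply: eq_all_on => j jC; rewrite E1 E2; case: eqP => [je|_].
    by rewrite -je jC in eC2.
  by case: eqP => // jt; rewrite -jt jC in tC2.
have a3 : all_on C1 y3 = all_on C1 x.
  apply: eq_all_on => j jC; rewrite E2; case: eqP => [jt|_].
    by rewrite -jt jC in tC1.
  rewrite E1 E2; case: eqP => [je|_]; first by rewrite -je jC in eC1.
  by case: eqP => // jt; rewrite -jt jC in tC1.
apply/ffunP => i; rewrite [LHS]E1 [RHS]apply_gateE all_onU a3 E2 a2 !E1 a1 !E2.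
rewrite eqxx (negPf et).
case: (eqVneq i e) => [->|ie]; first by rewrite (negPf et) addbK.
case: eqVneq => // ->; case: (x t); case: (x e); case: (all_on C1 x) => //=;
  by case: (all_on C2 x).
Qed.

(** The subcube with free coordinates [P]. The other lines are fixed to 1, not 0, so that they can
    act as satisfied controls. *)
Definition on_outside P : {pred vec m} := [pred x : vec m | all_on (~: P) x].

Lemma on_outsideP P (x : vec m) : reflect (forall i, i \notin P -> x i) (x \in on_outside P).
Proof.
apply: (iffP (all_onP _ _)) => H i; first by move=> iP; apply: H; rewrite inE.
by rewrite inE; apply: H.
Qed.

(** Pick a line [t] where [u] and [w] differ. CNOT gates from [t] make them agree on all other
    lines, NOT gates set those lines of [P] to 1, and the gate with controls [P :\ t] then exchanges
    the two images; the preparation is undone afterwards. Controls inside [P] are enough because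
    only the subcube matters. *)
Lemma swap_on P (u w : vec m) :
  2 * #|P| <= m -> u \in on_outside P -> w \in on_outside P -> u != w ->
  exists f, [/\ cost_le (8 * #|P|) f, f u = w, f w = u
    & {in on_outside P, forall y, y != u -> y != w -> f y = y}].
Proof.
move=> Pm /on_outsideP uP /on_outsideP wP uw.
have /existsP[t ut] : [exists t, u t != w t].
  rewrite -negb_forall; apply: contra uw => /forallP H.
  by apply/eqP/ffunP => i; apply/eqP.
have tP : t \in P by apply: contraNT ut => tP; rewrite uP // wP.
pose D := [set i in P :\ t | u i != w i].
have tD : t \notin D by rewrite !inE eqxx.
have DP : D \subset P :\ t by apply/subsetP => i; rewrite !inE => /andP[].
have cP : #|P| = #|P :\ t|.+1 by rewrite (cardsD1 t) tP.
have h1 : cost_le #|D| (layer D (fun=> [set t])).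
  apply: cost_le_layer => [i _|i j _ jD]; first by rewrite cards1.
  by rewrite inE; apply: contraNneq tD => <-.
set f1 := layer _ _ in h1.
have f1E x i : f1 x i = if i \in D then x i (+) x t else x i.
  by rewrite ffunE all_on1.
have f1P x i : i \notin P -> f1 x i = x i.
  move=> iP; rewrite f1E ifN //; apply: contra iP => /(subsetP DP).
  by rewrite !inE => /andP[].
have f1uw i : i != t -> f1 u i = f1 w i.
  move=> it; rewrite !f1E; case: (boolP (i \in D)) => iD.
    move: iD ut; rewrite !inE => /andP[_].
    by case: (u i); case: (w i); case: (u t); case: (w t).
  have [iP|iP] := boolP (i \in P); last by rewrite uP ?wP.
  by move: iD; rewrite !inE it iP /= negbK => /eqP.
pose N := [set i in P :\ t | ~~ f1 u i].
have NP : N \subset P :\ t by apply/subsetP => i; rewrite !inE => /andP[].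
have h2 : cost_le #|N| (layer N (fun=> set0)).
  apply: cost_le_layer => [i _|i j _ jD]; first by rewrite cards0.
  by rewrite inE.
set f2 := layer _ _ in h2.
have f2E x i : f2 x i = if i \in N then ~~ x i else x i.
  by rewrite ffunE all_on0 addbT.
have f2P x i : i \notin P -> f2 x i = x i.
  move=> iP; rewrite f2E ifN //; apply: contra iP => /(subsetP NP).
  by rewrite !inE => /andP[].
have h3 := @cost_le_small_gate m (P :\ t) t ltac:(by rewrite !inE eqxx) ltac:(lia).
set f3 := apply_gate _ in h3.
pose L := f2 \o f1.
have hL : cost_le (#|D| + #|N|) L by apply: cost_le_comp.
have Lt x : L x t = x t.
  by rewrite /L /= f2E f1E (negPf tD) ifN // !inE eqxx.
have LP x i : i \notin P -> L x i = x i by move=> iP; rewrite /L /= f2P ?f1P.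
have Lu i : i != t -> L u i.
  move=> it; have [iP|iP] := boolP (i \in P); last by rewrite LP ?uP.
  by rewrite /L /= f2E !inE it iP /=; case: ifP => [//|/negbFE].
have Lw i : i != t -> L w i.
  move=> it; suff <- : L u i = L w i by apply: Lu.
  by rewrite /L /= !f2E f1uw.
have Linj := cost_le_inj hL.
have f3L x : (forall i, i != t -> L x i) ->
    f3 (L x) = [ffun i => if i == t then ~~ x t else true].
  move=> H; apply/ffunP => i; rewrite apply_gateE [RHS]ffunE.
  have -> : all_on (P :\ t) (L x).
    by apply/all_onP => j; rewrite !inE => /andP[jt _]; apply: H.
  by case: (eqVneq i t) => [->|it]; rewrite ?Lt ?addbT ?H.
have LE x : (forall i, i != t -> L x i) -> L x = [ffun i => if i == t then x t else true].
  move=> H; apply/ffunP => i; rewrite [RHS]ffunE.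
  by case: (eqVneq i t) => [->|/H //]; rewrite Lt.
have f3u : f3 (L u) = L w.
  by rewrite f3L // LE //; apply/ffunP => i; rewrite !ffunE; move: ut; case: (u t); case: (w t).
have f3w : f3 (L w) = L u.
  by rewrite f3L // LE //; apply/ffunP => i; rewrite !ffunE; move: ut; case: (u t); case: (w t).
have [Li [hLi LK LiK]] := cost_le_inv hL.
exists (Li \o (f3 \o L)); split.
- apply: cost_leW (cost_le_comp (cost_le_comp hL h3) hLi).
  by have := subset_leq_card DP; have := subset_leq_card NP; lia.
- by rewrite /= f3u LK.
- by rewrite /= f3w LK.
move=> y /on_outsideP yP yu yw; rewrite /=.
suff -> : f3 (L y) = L y by rewrite LK.
apply/ffunP => i; rewrite apply_gateE; case: eqP => // _.
case: (boolP (all_on _ _)) => [/all_onP H|]; last by rewrite addbF.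
have Ly j : j != t -> L y j.
  move=> jt; have [jP|jP] := boolP (j \in P); last by rewrite LP ?yP.
  by apply: H; rewrite !inE jt.
have [yt|yt] := eqVneq (y t) (u t).
  case/eqP: yu; apply: Linj; rewrite (LE y) // (LE u) //; apply/ffunP => j.
  by rewrite [LHS]ffunE [RHS]ffunE yt.
case/eqP: yw; apply: Linj; rewrite (LE y) // (LE w) //; apply/ffunP => j.
rewrite [LHS]ffunE [RHS]ffunE.
by move: yt ut; case: (y t); case: (u t); case: (w t).
Qed.

(** The indices are treated one by one, swapping the current position of [v j] with [w j]. Vectors
    already placed are not touched, by injectivity of [w] and of [f \o v], and each swap preserves
    the subcube. *)
Lemma route_on P (I : finType) (v w : I -> vec m) (s : seq I) :
  2 * #|P| <= m -> injective v -> injective w ->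
  (forall j, v j \in on_outside P) -> (forall j, w j \in on_outside P) ->
  exists f, [/\ cost_le (size s * (8 * #|P|)) f, {in s, forall j, f (v j) = w j}
    & {in on_outside P, forall y, f y \in on_outside P}].
Proof.
move=> Pm vI wI vP wP; elim: s => [|j s [f [fc fs fP]]].
  by exists id; split=> //; apply: cost_le_id.
have fI := cost_le_inj fc.
have [js|js] := boolP (j \in s).
  exists f; split=> //; first by apply: cost_leW fc; rewrite /=; lia.
  by move=> k; rewrite inE => /orP[/eqP->|]; apply: fs.
have [fj|fj] := eqVneq (f (v j)) (w j).
  exists f; split=> //; first by apply: cost_leW fc; rewrite /=; lia.
  by move=> k; rewrite inE => /orP[/eqP->|/fs].
have [g [gc g1 g2 gy]] := swap_on Pm (fP _ (vP j)) (wP j) fj.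
exists (g \o f); split.
- by rewrite /= mulSn addnC; apply: cost_le_comp.
- move=> k; rewrite inE; case: eqVneq => [-> _ //|kj /= ks] /=.
  rewrite fs // gy //; last by rewrite (inj_eq wI).
  by rewrite -fs // (inj_eq fI) (inj_eq vI).
- move=> y /fP yP /=; have [->|n1] := eqVneq (f y) (f (v j)); first by rewrite g1.
  have [->|n2] := eqVneq (f y) (w j); first by rewrite g2 fP.
  by rewrite gy.
Qed.

(* Each line is a column of the array of the [v j]; a line whose column repeats
   that of its representative is cleared by a single CNOT. *)
Lemma clear_duplicate_lines T (I : finType) (v : I -> vec m) :
  exists P f, [/\ T \subset P, #|P| <= 2 ^ #|I| + #|T|, cost_le (2 * m) f
    & forall j, f (v j) \in on_outside P].
Proof.
pose col i := [ffun j => v j i].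
(* The line [i] itself passes the test, and the test depends only on the column, so lines with equal
   columns get the same representative. *)
pose rep i := odflt i [pick k | col k == col i].
have colr i : col (rep i) = col i.
  by rewrite /rep; case: pickP => [k /eqP|].
have repE i k : col i = col k -> rep i = rep k.
  move=> ik; rewrite /rep ik; case: pickP => // H.
  by have := H k; rewrite eqxx.
have repr i : rep (rep i) = rep i by apply: repE.
pose P := T :|: (rep @: 'I_m).
have DT : #|~: P| <= m by rewrite -[X in _ <= X]card_ord max_card.
have h1 : cost_le #|~: P| (layer (~: P) (fun i => [set rep i])).
  apply: cost_le_layer => [i _|i j _]; first by rewrite cards1.
  rewrite !inE negb_or => /andP[_]; apply: contraNneq => ->.
  exact: imset_f.
have h2 : cost_le #|~: P| (layer (~: P) (fun=> set0)).
  apply: cost_le_layer => [i _|i j _ _]; first by rewrite cards0.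
  by rewrite inE.
exists P, (layer (~: P) (fun=> set0) \o layer (~: P) (fun i => [set rep i])); split.
- exact: subsetUl.
- rewrite addnC (leq_trans (leq_card_setU _ _)) // leq_add2l.
  have -> : #|rep @: 'I_m| = #|col @: (rep @: 'I_m)|.
    rewrite card_in_imset // => i k /imsetP[i' _ ->] /imsetP[k' _ ->] /repE.
    by rewrite !repr.
  by rewrite (leq_trans (max_card _)) // card_ffun card_bool.
- by apply: cost_leW (cost_le_comp h1 h2); lia.
move=> j; apply/on_outsideP => i iP; rewrite !ffunE !in_setC iP all_on0 all_on1.
have := congr1 (fun c : {ffun I -> bool} => c j) (colr i); rewrite !ffunE => ->.
by rewrite addbb.
Qed.

(* [2 m] to clear lines and [16 k |P|] to route on [P], with [|P| <= 2 * 4 ^ k],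
   both done and undone, around a central gate of cost [8 m]. *)
Definition group_cost k := 12 * m + 64 * k * 4 ^ k.

(** The vectors are carried by [L] to a subcube of dimension [k + 1]: line [t] records the side [a]
    or [b], and the [k] lines of [S] encode the index as a subset of [S]. The gate targeting [t] and
    controlled by all lines outside [t |: S] flips [t] exactly on this subcube. Since the subcube
    contains nothing but the images of the [2 * 2 ^ k] vectors, conjugating by [L] fixes all the
    rest. *)
Lemma cost_le_group (k : nat) (a b : 'I_(2 ^ k) -> vec m) :
  0 < k -> 4 * 4 ^ (2 ^ k) <= m ->
  injective (fun p : 'I_(2 ^ k) * bool => if p.2 then b p.1 else a p.1) ->
  exists f, [/\ cost_le (group_cost (2 ^ k)) f,
    forall j, f (a j) = b j, forall j, f (b j) = a j
    & forall x, (forall j, x != a j) -> (forall j, x != b j) -> f x = x].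
Proof.
move=> k0; set K := 2 ^ k => Km vI.
set v := fun _ => _ in vI.
have kK : k < K by apply: ltn_expl.
have K4 : K < 4 ^ K by apply: ltn_expl.
have km : k < m by lia.
pose t : 'I_m := Ordinal (leq_ltn_trans (leq0n k) km).
pose S := [set i : 'I_m | 0 < i <= k].
have cS : #|S| = k.
  have : #|S| = #|[set: 'I_k]|; last by rewrite cardsT card_ord.
  apply/esym; rewrite -(card_imset _ (f := fun i : 'I_k => Ordinal (leq_ltn_trans (ltn_ord i) km))).
    apply: eq_card => i; apply/imsetP/idP => [[j _ ->]|]; first by rewrite inE /=.
    rewrite inE => /andP[i0 ik]; have ik' : i.-1 < k by lia.
    by exists (Ordinal ik') => //; apply: val_inj => /=; lia.
  by move=> i j [] /val_inj.
have SE i : (i \in S) = (0 < i <= k) by rewrite inE.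
clearbody S; have tS : t \notin S by rewrite SE.
have cT : #|t |: S| = k.+1 by rewrite cardsU1 tS cS.
have EK : K = #|powerset S| by rewrite card_powerset cS.
pose idx (j : 'I_K) : {set 'I_m} := enum_val (cast_ord EK j).
pose w (p : 'I_K * bool) : vec m :=
  [ffun i => if i == t then p.2 else if i \in S then i \in idx p.1 else true].
have wI : injective w.
  move=> [j b1] [j' b2] /ffunP jj.
  have := jj t; rewrite !ffunE eqxx /= => ->; congr (_, _).
  apply: (@cast_ord_inj _ _ EK); apply: enum_val_inj; apply/setP => i.
  have sub (l : 'I_K) : idx l \subset S by have := enum_valP (cast_ord EK l); rewrite inE.
  have [iS|iS] := boolP (i \in S).
    have it : i != t by apply: contraNneq tS => <-.
    by have := jj i; rewrite !ffunE iS /= (negPf it).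
  by transitivity false; [|symmetry]; apply: contraNF iS => /(subsetP (sub _)).
have wsurj x : x \in on_outside (t |: S) -> exists p, x = w p.
  move/on_outsideP => xT; pose B := [set i in S | x i].
  have BS : B \in powerset S by rewrite inE; apply/subsetP => i; rewrite inE => /andP[].
  exists (cast_ord (esym EK) (enum_rank_in BS B), x t).
  apply/ffunP => i; rewrite ffunE /= /idx cast_ordKV enum_rankK_in //.
  case: eqVneq => [->//|it]; case: ifP => iS; first by rewrite inE iS.
  by rewrite xT // !inE negb_or it iS.
have [P [f1 [TP cP h1 f1P]]] := clear_duplicate_lines (t |: S) v.
have f1I := cost_le_inj h1.
(* The array has [2 * K] rows, hence at most [4 ^ K] columns; the [k + 1] lines of [t |: S] fit in a
   second [4 ^ K]. *)
have {}cP : #|P| <= 2 * 4 ^ K.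
  have e4 : 2 ^ (K * 2) = 4 ^ K by rewrite mulnC expnM.
  by move: cP; rewrite card_prod card_bool card_ord cT e4; lia.
have wP p : w p \in on_outside P.
  apply/on_outsideP => i iP; have : i \notin t |: S by apply: contra iP => /(subsetP TP).
  by rewrite !inE negb_or ffunE => /andP[/negPf-> /negPf->].
have [f2 [h2 f2v _]] := @route_on P _ (f1 \o v) w (enum {: 'I_K * bool}) ltac:(lia)
  (inj_comp f1I vI) wI f1P wP.
pose L := f2 \o f1; have hL := cost_le_comp h1 h2.
have Lv p : L (v p) = w p by apply: f2v; rewrite mem_enum.
have [Li [hLi LK LiK]] := cost_le_inv hL.
have Liw p : Li (w p) = v p by rewrite -Lv LK.
have one_S : Ordinal (leq_ltn_trans k0 km) \in S by rewrite SE /= k0.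
have h3 : cost_le (8 * m) (apply_gate (~: (t |: S), t)).
  apply: (cost_le_big_gate (e := Ordinal (leq_ltn_trans k0 km))).
  - by rewrite !inE eqxx.
  - by rewrite in_setC in_setU one_S orbT.
  - by apply: contraNneq tS => <-.
set G := apply_gate _ in h3.
have Gw j c : G (w (j, c)) = w (j, ~~ c).
  apply/ffunP => i; rewrite apply_gateE.
  have -> : all_on (~: (t |: S)) (w (j, c)).
    apply/all_onP => l; rewrite !inE negb_or ffunE => /andP[].
    by move=> /negPf-> /negPf->.
  by rewrite !ffunE /= addbT; case: eqVneq.
exists (Li \o (G \o L)); split.
- apply: cost_leW (cost_le_comp (cost_le_comp hL h3) hLi).
  rewrite -cardE card_prod card_bool card_ord /group_cost.
  (* [L] costs at most [2 * m + 32 * K * 4 ^ K]; doing and undoing it around [8 * m] gives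
     [group_cost]. *)
  have : K * 2 * (8 * #|P|) <= 32 * K * 4 ^ K.
    rewrite (_ : 32 * K * 4 ^ K = K * 2 * (8 * (2 * 4 ^ K))); last by lia.
    by rewrite !leq_mul2l cP !orbT.
  lia.
- by move=> j; rewrite /= (Lv (j, false)) Gw Liw.
- by move=> j; rewrite /= (Lv (j, true)) Gw Liw.
move=> x xa xb /=; suff -> : G (L x) = L x by rewrite LK.
apply/ffunP => i; rewrite apply_gateE; case: eqP => // _.
case: (boolP (all_on _ _)) => [/wsurj[[j c] Lx]|]; last by rewrite addbF.
have xv : x = v (j, c) by rewrite -[x]LK -Liw -Lx.
by move: (xa j) (xb j); rewrite xv /v; case: c {Lx xv} => /=; rewrite eqxx.
Qed.

End Group.

(** * Evenness of circuits on more than three lines *)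

Section Parity.
Local Open Scope group_scope.

(* A line idle in the gate splits the action of the gate into two conjugate halves. *)
Lemma gate_even m (g : gate m) (s : {perm vec m}) :
  3 < m -> valid_gate g -> s =1 apply_gate g -> odd_perm s = false.
Proof.
move=> m3; case: g => C t /andP[/= tC C2] sg.
(* The gate occupies at most three lines, so [3 < m] leaves one idle. *)
have /set0Pn[e] : ~: (t |: C) != set0.
  rewrite -card_gt0 -[X in _ < X](addKn #|t |: C|) cardsC card_ord subn_gt0.
  by rewrite cardsU1 tC; apply: leq_ltn_trans m3; rewrite add1n ltnS.
rewrite !inE negb_or => /andP[et eC].
have gK := @apply_gateK m (C, t) tC.
have flipK := @apply_gateK m (set0, e) ltac:(by rewrite inE).
set G := apply_gate (C, t) in gK sg; set F := apply_gate (set0, e) in flipK.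
have FE x i : F x i = if i == e then ~~ x i else x i.
  by rewrite apply_gateE all_on0 addbT.
have Ge x : G x e = x e by rewrite apply_gateE (negPf et).
have GF x : G (F x) = F (G x).
  apply/ffunP => i; rewrite FE !apply_gateE all_on0 addbT.
  rewrite (@eq_all_on _ C (F x) x) => [|j jC]; last first.
    by rewrite FE ifN //; apply: contraNneq eC => <-.
  case: eqVneq => [->|//]; first by rewrite eq_sym (negPf et).
pose H (x : vec m) := if x e then x else G x.
have HK : involutive H.
  by move=> x; rewrite /H; case xe: (x e); rewrite ?Ge xe ?gK.
pose h := perm (can_inj HK); pose f := perm (can_inj flipK).
have fV : f^-1 = f.
  by apply/eqP; rewrite eq_invg_mul; apply/eqP/permP => x; rewrite permM !permE flipK.
have -> : s = h * h ^ f.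
  apply/permP => x; rewrite conjgE fV !permM !permE sg /H.
  case: (boolP (x e)) => xe; last by rewrite FE eqxx Ge (negPf xe) flipK.
  by rewrite FE eqxx xe GF flipK.
by rewrite odd_permM odd_permJ addbb.
Qed.

Lemma circuit_even m (c : seq (gate m)) (s : {perm vec m}) :
  3 < m -> all (@valid_gate m) c -> s =1 run_circuit c -> odd_perm s = false.
Proof.
move=> m3; elim: c s => [|g c IH] s /=.
  by move=> _ s1; rewrite (_ : s = 1) ?odd_perm1 //; apply/permP => x; rewrite s1 perm1.
case/andP=> gv cv sE; have gK := apply_gateK (proj1 (andP gv)).
pose g' := perm (can_inj gK).
rewrite -[s](mulKVg g') odd_permM (gate_even m3 gv) => [|x]; last first.
  by rewrite permE.
apply: IH => // x; rewrite permM sE.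
have -> : run_circuit (g :: c) (g'^-1 x) = run_circuit c (g' (g'^-1 x)) by rewrite [g' _]permE.
by rewrite permKV.
Qed.

Lemma cost_le_even m k (s : {perm vec m}) :
  3 < m -> cost_le k s -> odd_perm s = false.
Proof.
by move=> m3 [c [cv _ cs]]; apply: circuit_even m3 cv _ => x; rewrite cs.
Qed.

End Parity.

(** * Lists of swaps and pairs of transpositions *)

Lemma cost_le_swaps m k (l : seq (vec m * vec m)) :
  0 < k -> 4 * 4 ^ (2 ^ k) <= m -> size l = 2 ^ k ->
  uniq (unzip1 l ++ unzip2 l) ->
  exists f, [/\ cost_le (group_cost m (2 ^ k)) f,
    {in l, forall p, f p.1 = p.2}, {in l, forall p, f p.2 = p.1}
    & forall x, x \notin unzip1 l ++ unzip2 l -> f x = x].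
Proof.
move=> k0 km sl lu; pose x0 : vec m := [ffun=> false].
have s1 : size (unzip1 l) = 2 ^ k by rewrite size_map.
have s2 : size (unzip2 l) = 2 ^ k by rewrite size_map.
pose a (j : 'I_(2 ^ k)) := nth x0 (unzip1 l) j.
pose b (j : 'I_(2 ^ k)) := nth x0 (unzip2 l) j.
have vE (p : 'I_(2 ^ k) * bool) : (if p.2 then b p.1 else a p.1)
    = nth x0 (unzip1 l ++ unzip2 l) (p.2 * 2 ^ k + p.1).
  case: p => j [] /=; rewrite nth_cat s1.
    by rewrite mul1n ltnNge leq_addr addKn.
  by rewrite mul0n add0n ltn_ord.
have vI : injective (fun p : 'I_(2 ^ k) * bool => if p.2 then b p.1 else a p.1).
  move=> p q /eqP; rewrite !vE nth_uniq // ?size_cat ?s1 ?s2.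
  - case: p q => [i c] [j d] /= /eqP ij.
    have := ltn_ord i; have := ltn_ord j.
    case: c d ij => [] []; rewrite ?mul1n ?mul0n => ij li lj; try lia.
      by congr (_, _); apply: val_inj => /=; lia.
    by congr (_, _); apply: val_inj => /=; lia.
  - by have := ltn_ord p.1; case: (p.2) => /=; lia.
  - by have := ltn_ord q.1; case: (q.2) => /=; lia.
have [f [fc fa fb fx]] := cost_le_group k0 km vI.
have pE p : p \in l -> exists j, p = (a j, b j).
  move=> pl; have il : index p l < 2 ^ k by rewrite -sl index_mem.
  exists (Ordinal il); rewrite /a /b /= !(nth_map (x0, x0)) ?index_mem //.
  by rewrite nth_index //; case: p {pl il}.
exists f; split=> //.
- by move=> p /pE[j ->]; apply: fa.
- by move=> p /pE[j ->]; apply: fb.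
move=> x; rewrite mem_cat negb_or => /andP[x1 x2].
by apply: fx => j; [apply: contraNneq x1 | apply: contraNneq x2] => ->;
  rewrite mem_nth // ?s1 ?s2.
Qed.

(** The case [k = 1] of the block swap; 64 is its requirement [4 * 4 ^ 2]. *)
Lemma cost_le_two_disjoint_tperm m (x y d e : vec m) :
  64 <= m -> uniq [:: x; y; d; e] ->
  cost_le (group_cost m 2) (tperm x y * tperm d e)%g.
Proof.
move=> m64 u.
have [||||f [fc f1 f2 f3]] := @cost_le_swaps m 1 [:: (x, y); (d, e)] => //=.
  move: u; rewrite /= !inE !negb_or => /and4P[/and3P[-> -> ->] /andP[yd ->] -> _].
  by rewrite eq_sym yd.
apply: cost_le_eq fc => z; rewrite permM.
move: u; rewrite /= !inE !negb_or => /and4P[/and3P[xy xd xe] /andP[yd ye] de _].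
have i1 : (x, y) \in [:: (x, y); (d, e)] by rewrite inE eqxx.
have i2 : (d, e) \in [:: (x, y); (d, e)] by rewrite !inE eqxx orbT.
case: (tpermP x y z) => [->|->|/eqP zx /eqP zy].
- by rewrite (f1 _ i1) /= tpermD // eq_sym.
- by rewrite (f2 _ i1) /= tpermD // eq_sym.
case: (tpermP d e z) => [->|->|/eqP zd /eqP ze].
- exact: (f1 _ i2).
- exact: (f2 _ i2).
by apply: f3; rewrite /= !inE !negb_or zx zy zd ze.
Qed.

Definition pair_cost m := 2 * group_cost m 2.

(** The two transpositions may overlap. A transposition of two vectors [d], [e] away from both is
    inserted twice, giving two products of disjoint transpositions. *)
Lemma cost_le_two_tperm m (x y x' y' : vec m) :
  64 <= m -> x != y -> x' != y' ->
  cost_le (pair_cost m) (tperm x y * tperm x' y')%g.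
Proof.
move=> m64 xy xy'; pose X := [set x; y; x'; y'].
have cX : #|X| <= 4.
  rewrite /X; do 3!(rewrite setUC; apply: leq_trans (leq_card_setU _ _) _; rewrite cards1 add1n ltnS).
  by rewrite cards1.
have : 1 < #|~: X|.
  have := cardsC X; rewrite card_ffun card_bool card_ord.
  have : 2 ^ 6 <= 2 ^ m by rewrite leq_exp2l //; apply: leq_trans m64.
  by lia.
case/card_gt1P => d [e [dX eX de]].
move: dX eX; rewrite !inE !negb_or.
move=> /andP[/andP[/andP[dx dy] dx'] dy'] /andP[/andP[/andP[ex ey] ex'] ey'].
have c1 : cost_le (group_cost m 2) (tperm x y * tperm d e)%g.
  apply: cost_le_two_disjoint_tperm => //.
  by rewrite /= !inE !negb_or xy de ![x == _]eq_sym ![y == _]eq_sym dx ex dy ey.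
have c2 : cost_le (group_cost m 2) (tperm d e * tperm x' y')%g.
  apply: cost_le_two_disjoint_tperm => //.
  by rewrite /= !inE !negb_or xy' de dx' ex' dy' ey'.
rewrite /pair_cost mul2n -addnn; apply: cost_le_eq (cost_le_comp c1 c2) => z.
by rewrite /= !permM tpermK.
Qed.

(** Greedy choice: [k] elements already chosen occupy at most [2 * k] values, which exclude at most
    [2 * k] candidates through [r] and as many through [s]. *)
Lemma disjoint_pairs (T : finType) (r s : T -> T) (D : {set T}) k :
  injective r -> injective s -> {in D, forall a, r a != s a} -> 4 * k <= #|D| ->
  exists l, [/\ size l = k, {subset l <= D} & uniq (map r l ++ map s l)].
Proof.
move=> rI sI rs; elim: k => [|k IH] kD; first by exists [::].
have [l [sl lD lu]] := IH ltac:(lia).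
set X := map r l ++ map s l in lu.
have cX : #|[set x in X]| <= 2 * k.
  by rewrite cardsE (leq_trans (card_size _)) // size_cat !size_map sl addnn mul2n.
have /set0Pn[a] : D :\: (r @^-1: [set x in X] :|: s @^-1: [set x in X]) != set0.
  rewrite -card_gt0 cardsD subn_gt0.
  apply: leq_ltn_trans (subset_leq_card (subsetIr _ _)) _.
  apply: leq_ltn_trans (leq_card_setU _ _) _.
  by rewrite !card_preimset //; lia.
rewrite !inE negb_or => /andP[/andP[ra sa] aD].
exists (a :: l); split; first by rewrite /= sl.
  by move=> x; rewrite inE => /orP[/eqP->|/lD].
have pX : perm_eq (map r (a :: l) ++ map s (a :: l)) [:: r a, s a & X].
  by rewrite perm_cons -[map s _]/([:: s a] ++ map s l); apply/permPl/perm_catCA.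
by rewrite (perm_uniq pX) /= inE negb_or rs // ra sa.
Qed.

(** * Routing the relevant inputs to their wanted positions *)

Section Route.
Variables (m : nat) (A : {set vec m}) (s : {perm vec m}).
Hypothesis m64 : 64 <= m.
Hypothesis A_room : A != setT -> 1 < #|~: A|.

Definition misplaced (r : {perm vec m}) := [set a in A | r a != s a].

(** No new error arises: if [r a = s a] with [a] outside [l], injectivity keeps this value out of
    both [map r l] and [map s l], so [t] fixes it. *)
Lemma misplaced_step (r t : {perm vec m}) (l : seq (vec m)) :
  {subset l <= misplaced r} -> {in l, forall a, t (r a) = s a} ->
  (forall x, x \notin map r l ++ map s l -> t x = x) ->
  misplaced (r * t)%g \subset misplaced r :\: [set a in l].
Proof.
move=> lD tl tx; apply/subsetP => a; rewrite !inE permM => /andP[aA ta].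
have al : a \notin l by apply: contra ta => /tl ->.
rewrite al aA /=; apply: contra ta => /eqP ra.
rewrite tx ?ra // mem_cat negb_or (mem_map perm_inj) al andbT.
by rewrite -ra (mem_map perm_inj).
Qed.

Lemma misplaced_tperm (r : {perm vec m}) a :
  a \in misplaced r ->
  misplaced (r * tperm (r a) (s a))%g \subset misplaced r :\ a.
Proof.
move=> aD; rewrite (_ : [set a] = [set x in [:: a]]); last first.
  by apply/setP => x; rewrite !inE.
apply: misplaced_step => [x|x|x]; first by rewrite inE => /eqP->.
  by rewrite inE => /eqP->; rewrite tpermL.
by rewrite !inE negb_or => /andP[xr xs]; rewrite tpermD // eq_sym.
Qed.

Lemma misplaced0 (r : {perm vec m}) :
  misplaced r = set0 -> {in A, forall x, r x = s x}.
Proof.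
move=> D0 x xA; apply/eqP; have : x \notin misplaced r by rewrite D0 inE.
by rewrite inE xA negbK.
Qed.

(** Each round corrects one input by [t1] and needs a partner transposition. It corrects a second
    input if one is left; otherwise it swaps two vectors outside the image of [A], which [A_room]
    provides. *)
Lemma route_few d (r : {perm vec m}) :
  (A = setT -> odd_perm r = odd_perm s) -> #|misplaced r| <= d ->
  exists f, cost_le (d * pair_cost m) f /\ {in A, forall x, f (r x) = s x}.
Proof.
elim: d r => [|d IH] r par Dd.
  exists id; split; first exact: cost_le_id.
  by apply: misplaced0; apply: cards0_eq; lia.
have [D0|[a aD]] := set_0Vmem (misplaced r).
  exists id; split; last exact: misplaced0.
  by apply: cost_leW (cost_le_id m).
have rsa : r a != s a by move: aD; rewrite inE => /andP[].
set t1 := tperm (r a) (s a).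
have D1 : misplaced (r * t1)%g \subset misplaced r :\ a by apply: misplaced_tperm.
have card1 : #|misplaced (r * t1)%g| <= d.
  by have := subset_leq_card D1; move: Dd; rewrite (cardsD1 a) aD; lia.
suff [x [y [xy D2]]] : exists x y, x != y /\
    misplaced (r * t1 * tperm x y)%g \subset misplaced (r * t1)%g.
  have c2 := cost_le_two_tperm m64 rsa xy.
  have par2 : A = setT -> odd_perm (r * t1 * tperm x y)%g = odd_perm s.
    by move/par=> <-; rewrite !odd_permM !odd_tperm rsa xy !addbT negbK.
  have [f [fc fA]] := IH _ par2 (leq_trans (subset_leq_card D2) card1).
  exists (f \o (t1 * tperm x y)%g); split.
    by rewrite mulSn; apply: cost_le_comp.
  by move=> z zA; rewrite -(fA z zA) /= !permM.
have [D0|[b bD]] := set_0Vmem (misplaced (r * t1)%g); last first.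
  exists ((r * t1)%g b), (s b); split; first by move: bD; rewrite inE => /andP[].
  by apply: subset_trans (misplaced_tperm bD) (subsetDl _ _).
have rs := misplaced0 D0.
(* If [A] is everything, [r * t1] is already [s], so [r] and [s] would have opposite parities,
   against [par]. *)
have [AT|/A_room] := eqVneq A setT.
  have rsE : (r * t1)%g = s by apply/permP => x; apply: rs; rewrite AT inE.
  by have := par AT; rewrite -rsE odd_permM odd_tperm rsa addbT; case: odd_perm.
have cA : #|~: A| = #|~: ((r * t1)%g @: A)|.
  by apply/eqP; rewrite -(eqn_add2l #|A|) cardsC -(card_imset A (@perm_inj _ (r * t1)%g)) cardsC.
rewrite cA => /card_gt1P[x [y [xA yA xy]]]; exists x, y; split=> //.
apply/subsetP => z; rewrite !inE permM => /andP[zA].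
have zr w : w \in ~: ((r * t1)%g @: A) -> w != (r * t1)%g z.
  by rewrite inE; apply: contraNneq => ->; apply: imset_f.
by rewrite tpermD ?zr // zA.
Qed.

(** Blocks are used until at most [4 * 2 ^ k] inputs are misplaced, then [route_few] finishes.
    Multiplying the cost by [2 ^ k] charges one [group_cost] to each misplaced input, without
    division. *)
Lemma route k (r : {perm vec m}) :
  0 < k -> 4 * 4 ^ (2 ^ k) <= m ->
  (A = setT -> odd_perm r = odd_perm s) ->
  exists c f, [/\ cost_le c f, {in A, forall x, f (r x) = s x} &
    2 ^ k * c <= #|misplaced r| * group_cost m (2 ^ k)
                 + 2 ^ k * (4 * 2 ^ k * pair_cost m)].
Proof.
move=> k0 km; set K := 2 ^ k.
have K0 : 0 < K by rewrite expn_gt0.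
have [d] := ubnP #|misplaced r|; elim: d r => // d IH r Dd par.
have [few|many] := leqP #|misplaced r| (4 * K).
  have [f [fc fA]] := route_few par few.
  by exists (4 * K * pair_cost m), f; split=> //; apply: leq_addl.
have rs : {in misplaced r, forall a, r a != s a} by move=> a; rewrite inE => /andP[].
have [l [sl lD lu]] := disjoint_pairs (@perm_inj _ r) (@perm_inj _ s) rs (ltnW many).
pose ps := [seq (r a, s a) | a <- l].
have ps1 : unzip1 ps = map r l by rewrite /unzip1 -map_comp.
have ps2 : unzip2 ps = map s l by rewrite /unzip2 -map_comp.
have [||f [fc f1 _ fx]] := @cost_le_swaps m k ps k0 km.
- by rewrite size_map.
- by rewrite ps1 ps2.
pose t := perm (cost_le_inj fc).
have tE x : t x = f x by rewrite permE.
have D1 : misplaced (r * t)%g \subset misplaced r :\: [set a in l].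
  apply: misplaced_step => // [a al|x xl]; rewrite tE.
    by apply: (f1 (r a, s a)); apply: map_f.
  by apply: fx; rewrite ps1 ps2.
have ul : uniq l.
  by apply: (@map_uniq _ _ r); move: lu; rewrite cat_uniq => /andP[].
have cl : #|[set a in l]| = K by rewrite cardsE -sl; apply/card_uniqP.
have lsub : [set a in l] \subset misplaced r.
  by apply/subsetP => a; rewrite inE; apply: lD.
have cD : #|misplaced (r * t)%g| + K <= #|misplaced r|.
  have := subset_leq_card D1; rewrite cardsD (setIidPr lsub) cl.
  have := subset_leq_card lsub; rewrite cl; lia.
have tc : cost_le (group_cost m K) t by apply: (cost_le_eq _ fc) => x; rewrite tE.
(* The block is computed by a circuit, hence even, and the parity condition survives. *)
have par1 : A = setT -> odd_perm (r * t)%g = odd_perm s.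
  move/par=> <-; rewrite odd_permM (cost_le_even _ tc) ?addbF //.
  exact: leq_trans m64.
have [c [g [gc gA cb]]] := IH (r * t)%g ltac:(lia) par1.
exists (group_cost m K + c), (g \o t); split.
- exact: cost_le_comp.
- by move=> x xA; rewrite -(gA x xA) permM.
rewrite mulnDr; apply: leq_trans (leq_add (leqnn _) cb) _.
by rewrite addnA leq_add2r -mulnDl leq_mul2r addnC cD orbT.
Qed.

End Route.

(** * Synthesis with at most [n] additional inputs *)

Lemma phi_inj n q : injective (@phi n q).
Proof.
move=> x y /ffunP xy; apply/ffunP => i; have := xy (lshift q i).
by rewrite !ffunE (unsplitK (inl i : 'I_n + 'I_q)).
Qed.

Lemma circuit_perm m (c : seq (gate m)) :
  all (@valid_gate m) c -> exists s : {perm vec m}, s =1 run_circuit c.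
Proof.
move=> cv; have cK := run_circuit_revK cv.
by exists (perm (can_inj cK)) => x; rewrite permE.
Qed.

Lemma exp_bounds K : 8 <= K -> 32 * K <= 2 ^ K /\ 4 * 4 ^ K <= 8 ^ K.
Proof.
move=> K8; split.
  rewrite -(subnK K8); elim: (K - 8) => // j IH.
  by rewrite addSn expnS; lia.
rewrite -[8]/(2 * 4) expnMn leq_mul2r -[X in X <= _]/(2 ^ 2) leq_exp2l //.
by rewrite (leq_trans _ K8) ?orbT.
Qed.

(** In [group_cost], [12 * m] is at most [24 * n] and [64 * K * 4 ^ K] is at most [2 * 8 ^ K], so at
    most [2 * n]: the blocks cost [26 * n] per input. The final pairs cost at most
    [200 * K * K * n], which fits in one more [n * 2 ^ n]. *)
Lemma route_cost_bound n m K :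
  8 <= K -> 8 ^ K <= n -> m <= 2 * n ->
  2 ^ n * group_cost m K + K * (4 * K * pair_cost m) <= 27 * n * 2 ^ n.
Proof.
move=> K8 Kn mn; have [e1 e2] := exp_bounds K8.
have e8 : 8 ^ K = 2 ^ K * 4 ^ K by rewrite -expnMn.
have K4 : 32 * K * (32 * K) <= 4 ^ K.
  by rewrite -[4]/(2 * 2) expnMn leq_mul.
have big : 2048 <= n.
  apply: leq_trans Kn; apply: (@leq_trans (8 ^ 4)) => //; rewrite leq_exp2l //.
  exact: leq_trans K8.
have n2 : n < 2 ^ n by apply: ltn_expl.
have g : group_cost m K <= 26 * n.
  have : 32 * K * 4 ^ K <= 2 ^ K * 4 ^ K by rewrite leq_mul2r e1 orbT.
  by rewrite /group_cost -e8; lia.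
have p : pair_cost m <= 50 * n by rewrite /pair_cost /group_cost -[4 ^ 2]/16; lia.
have K2 : 200 * (K * K) <= 2 ^ n by lia.
have : 2 ^ n * group_cost m K <= 2 ^ n * (26 * n) by rewrite leq_mul2l g orbT.
have : K * (4 * K * pair_cost m) <= K * (4 * K * (50 * n)).
  by rewrite !leq_mul2l p !orbT.
have : 200 * (K * K) * n <= 2 ^ n * n by rewrite leq_mul2r K2 orbT.
lia.
Qed.

(** Routing starts from the identity, with [A] the set of inputs [(x, 0)]. For [q = 0] this is the
    whole space and [s] is even; for [q > 0] at least [2 ^ n] vectors lie outside. *)
Lemma synthesis n q k (s : {perm vec (n + q)}) :
  0 < k -> 8 <= 2 ^ k -> 8 ^ (2 ^ k) <= n -> q <= n ->
  (q = 0 -> odd_perm s = false) ->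
  exists c : seq (gate (n + q)), [/\ all (@valid_gate _) c,
    2 ^ k * size c <= 27 * n * 2 ^ n
    & forall x, run_circuit c (@phi n q x) = s (@phi n q x)].
Proof.
move=> k0 K8 Kn qn par; pose A := [set @phi n q x | x in setT].
have cA : #|A| = 2 ^ n.
  rewrite card_imset ?cardsT ?card_ffun ?card_bool ?card_ord //.
  exact: phi_inj.
have [_ e2] := exp_bounds K8.
have n64 : 64 <= n.
  by apply: leq_trans Kn; rewrite -[64]/(8 ^ 2) leq_exp2l //; apply: leq_trans K8.
have cC : #|~: A| = 2 ^ (n + q) - 2 ^ n.
  have := cardsC A; rewrite card_ffun card_bool card_ord cA => <-.
  by rewrite addKn.
have room : A != setT -> 1 < #|~: A|.
  move=> AT; rewrite cC; case: (posnP q) => [q0|q0].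
    case/eqP: AT; apply/eqP; rewrite eqEcard subsetT cA cardsT card_ffun.
    by rewrite card_bool card_ord -[X in _ <= 2 ^ X]addn0 leq_exp2l // leq_add2l q0.
  have : 2 ^ n.+1 <= 2 ^ (n + q) by rewrite leq_exp2l // -addn1 leq_add2l.
  have : 2 ^ 1 <= 2 ^ n by rewrite leq_exp2l //; apply: leq_trans n64.
  by rewrite expn1 expnS; lia.
have par1 : A = setT -> odd_perm (1 : {perm vec (n + q)}) = odd_perm s.
  move=> AT; rewrite odd_perm1 par //; move: cA.
  rewrite AT cardsT card_ffun card_bool card_ord => /eqP.
  by rewrite eqn_exp2l // -[X in _ == X]addn0 eqn_add2l => /eqP.
have m64 : 64 <= n + q by apply: leq_trans (leq_addr _ _).
have Km : 4 * 4 ^ (2 ^ k) <= n + q.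
  by apply: leq_trans e2 (leq_trans Kn (leq_addr _ _)).
have [c [f [[l [lv ls lf]] fA cb]]] := route m64 room k0 Km par1.
exists l; split=> //; last first.
  by move=> x; rewrite lf -fA ?perm1 //; apply: imset_f.
apply: leq_trans (route_cost_bound K8 Kn (m := n + q) _); last by lia.
apply: (leq_trans (leq_mul (leqnn _) ls)); apply: leq_trans cb _.
rewrite leq_add2r leq_mul2r -cA subset_leq_card ?orbT //.
by apply/subsetP => x; rewrite inE => /andP[].
Qed.

(** * Adding lines, and embedding an arbitrary map in a permutation *)

Section Lift.
Variables (m m' : nat) (h : 'I_m -> 'I_m').
Hypothesis h_inj : injective h.

Definition lift_gate (g : gate m) : gate m' := (h @: g.1, h g.2).

Lemma lift_gate_valid g : valid_gate g -> valid_gate (lift_gate g).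
Proof. by rewrite /valid_gate /= mem_imset // card_imset. Qed.

Lemma run_lift c (y : vec m') (x : vec m) :
  (forall i, y (h i) = x i) ->
  forall i, run_circuit (map lift_gate c) y (h i) = run_circuit c x i.
Proof.
elim: c y x => [|[C t] c IH] y x yx //=; apply: IH => i.
rewrite !apply_gateE (inj_eq h_inj) yx.
suff -> : all_on (h @: C) y = all_on C x by [].
apply/all_onP/all_onP => H j; first by move=> jC; rewrite -yx H // imset_f.
by case/imsetP => l lC ->; rewrite yx H.
Qed.

End Lift.

(** The map [(x, y) -> (f x (+) y, x)], bijective for any [f]. The halves are exchanged so that
    [f x] appears on the first [n] lines, where [psi] reads it. *)
Definition bennett n (f : vec n -> vec n) (y : vec (n + n)) : vec (n + n) :=
  [ffun i => match fintype.split i with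
             | inl j => f [ffun l => y (lshift n l)] j (+) y (rshift n j)
             | inr j => y (lshift n j)
             end].

Lemma bennett_inj n (f : vec n -> vec n) : injective (bennett f).
Proof.
move=> x y /ffunP xy.
have xyl j : x (lshift n j) = y (lshift n j).
  have := xy (rshift n j).
  by rewrite !ffunE (unsplitK (inr j : 'I_n + 'I_n)).
apply/ffunP => i; case: (fintype.splitP i) => j ij.
  by rewrite (_ : i = lshift n j) ?xyl //; apply: val_inj.
rewrite (_ : i = rshift n j); last exact: val_inj.
have := xy (lshift n j); rewrite !ffunE (unsplitK (inl j : 'I_n + 'I_n)).
have -> : [ffun l => x (lshift n l)] = [ffun l => y (lshift n l)] :> vec n.
  by apply/ffunP => l; rewrite !ffunE.
exact: addbI.
Qed.

Lemma bennettE n (f : vec n -> vec n) x j : bennett f (@phi n n x) (lshift n j) = f x j.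
Proof.
rewrite ffunE (unsplitK (inl j : 'I_n + 'I_n)) [X in _ (+) X]ffunE.
rewrite (unsplitK (inr j : 'I_n + 'I_n)) addbF; congr (f _ j); apply/ffunP => l.
by rewrite !ffunE (unsplitK (inl l : 'I_n + 'I_n)).
Qed.

(** * Complexity of a single map *)

Lemma complexity_le n q (f : vec n -> vec n) (c : seq (gate (n + q))) :
  implements c f -> @complexity n q f <= size c.
Proof.
move=> cf; rewrite /complexity; case: excluded_middle_informative => // H.
case: ex_minnP => k _ kmin; apply: kmin.
by apply/existsP; exists (in_tuple c).
Qed.

Lemma implementsP n q (f : vec n -> vec n) (c : seq (gate (n + q))) :
  reflect (all (@valid_gate _) c
    /\ forall x i, run_circuit c (@phi n q x) (lshift q i) = f x i)
    (implements c f).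
Proof.
apply: (iffP andP) => -[cv H]; split=> //.
  by move=> x i; have /eqP <- := forallP H x; rewrite ffunE.
by apply/forallP => x; apply/eqP/ffunP => i; rewrite ffunE H.
Qed.

(* For [q > n], [2 n] lines suffice: [bennett f] maps [(x, 0)] to [(f x, x)]. *)
Lemma complexity_bound n q k (f : vec n -> vec n) :
  0 < k -> 8 <= 2 ^ k -> 8 ^ (2 ^ k) <= n ->
  2 ^ k * @complexity n q f <= 27 * n * 2 ^ n.
Proof.
move=> k0 K8 Kn.
have n3 : 3 < n.
  by apply: leq_trans Kn; apply: (@leq_trans (8 ^ 1)) => //; rewrite leq_exp2l // expn_gt0.
suff [[c cf cs]|C0] : (exists2 c : seq (gate (n + q)), implements c f
    & 2 ^ k * size c <= 27 * n * 2 ^ n) \/ @complexity n q f = 0.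
- by apply: leq_trans cs; rewrite leq_mul2l complexity_le ?orbT.
- by rewrite C0 muln0.
have [qn|nq] := leqP q n.
  rewrite /complexity; case: excluded_middle_informative => [H|_]; last by right.
  left; case: H => l /existsP[c0 /implementsP[c0v c0f]].
  (* Any circuit implementing [f], however long, supplies an even permutation to be synthesised anew
     on the inputs [(x, 0)]. *)
  have [s sE] := circuit_perm c0v.
  have sev : odd_perm s = false.
    exact: circuit_even (leq_trans n3 (leq_addr _ _)) c0v sE.
  have [c [cv cs cE]] := synthesis k0 K8 Kn qn (fun=> sev).
  exists c => //; apply/implementsP; split=> // x i.
  by rewrite cE sE c0f.
(* With [n] additional inputs and [n > 0], the parity condition of [synthesis] holds vacuously. *)
left; have [|c [cv cs cE]] := @synthesis n n k (perm (@bennett_inj n f)) k0 K8 Kn (leqnn _).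
  by move=> n0; rewrite n0 in n3.
have nnq : n + n <= n + q by rewrite leq_add2l ltnW.
have hI : injective (widen_ord nnq) by move=> i j /(congr1 val) /= /val_inj.
exists (map (lift_gate (widen_ord nnq)) c); last by rewrite size_map.
apply/implementsP; split.
  by rewrite all_map; apply: sub_all cv => g; apply: lift_gate_valid.
move=> x i; rewrite (_ : lshift q i = widen_ord nnq (lshift n i)); last exact: val_inj.
rewrite (@run_lift _ _ _ hI _ _ (@phi n n x)); first by rewrite cE permE bennettE.
move=> j; rewrite !ffunE; case: (fintype.splitP j) => l jl.
  rewrite (_ : widen_ord nnq j = lshift q l); last exact: val_inj.
  by rewrite (unsplitK (inl l : 'I_n + 'I_q)).
have lq : l < q by apply: ltn_trans nq.
rewrite (_ : widen_ord nnq j = rshift n (Ordinal lq)); last exact: val_inj.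
by rewrite (unsplitK (inr (Ordinal lq) : 'I_n + 'I_q)).
Qed.

(** * Choice of the block size and the asymptotic bound *)

Lemma block_size n : 8 ^ 8 <= n ->
  exists k, [/\ 0 < k, 8 <= 2 ^ k, 8 ^ (2 ^ k) <= n & n < 2 ^ (6 * 2 ^ k)].
Proof.
move=> n8; have n0 : 0 < n by apply: leq_trans n8; rewrite expn_gt0.
have /andP[l1 l2] := trunc_log_bounds (isT : 1 < 8) n0.
(* Here [2 ^ k] is the largest power of two not exceeding [l], the integer part of the base 8
   logarithm of [n]; [8 ^ 8 <= n] forces [8 <= l], hence [3 <= k]. *)
set l := trunc_log 8 n in l1 l2.
have l8 : 8 <= l by apply: trunc_log_max.
have /andP[k1 k2] := trunc_log_bounds (isT : 1 < 2) (leq_trans (isT : 0 < 8) l8).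
set k := trunc_log 2 l in k1 k2.
have k3 : 3 <= k by apply: trunc_log_max.
exists k; split.
- exact: leq_trans k3.
- by rewrite -[8]/(2 ^ 3) leq_exp2l.
- by apply: leq_trans l1; rewrite leq_exp2l.
(* From [l + 1 <= 2 * 2 ^ k] follows [n < 8 ^ (2 * 2 ^ k)], which is [2 ^ (6 * 2 ^ k)]. *)
apply: leq_trans l2 _; rewrite -[8]/(2 ^ 3) -expnM leq_exp2l //.
by rewrite expnS in k2; lia.
Qed.

Lemma INR_expn a b : INR (a ^ b) = (INR a ^ b)%R.
Proof. by elim: b => // b IH; rewrite expnS mult_INR IH. Qed.

Theorem theorem1 :
  forall (q : nat -> nat) (eps : R), (0 < eps)%R ->
  exists N : nat, forall n : nat, leq N n ->
    (INR (L_shannon n (q n)) <= (1 + eps) * shannon_bound n)%R.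
Proof.
move=> q eps eps0; exists (8 ^ 8) => n n8.
have [k [k0 K8 Kn nK]] := block_size n8.
have n2 : 2 <= n.
  by apply: leq_trans Kn; apply: (@leq_trans (8 ^ 1)) => //; rewrite leq_exp2l // expn_gt0.
have K0 : 0 < 2 ^ k by rewrite expn_gt0.
have LK : L_shannon n (q n) * 2 ^ k <= 27 * n * 2 ^ n.
  rewrite -leq_divRL //; apply/bigmax_leqP => f _.
  by rewrite leq_divRL // mulnC complexity_bound.
have /le_INR := elimT leP LK; rewrite !mult_INR (INR_expn 2 n).
have -> : INR 27 = 27%R by rewrite INR_IZR_INZ.
have -> : INR 2 = 2%R by [].
move: (INR (L_shannon _ _)) => L.
have Kpos : (0 < INR (2 ^ k))%R by apply/lt_0_INR/ltP.
have n2R : (2 <= INR n)%R by have := le_INR _ _ (elimT leP n2).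
have ln2 : (0 < ln 2)%R by rewrite -ln_1; apply: ln_increasing; lra.
have lnn : (0 < ln (INR n))%R by rewrite -ln_1; apply: ln_increasing; lra.
have nR0 : (0 < INR n)%R by lra.
have lognK : (ln (INR n) <= 6 * INR (2 ^ k) * ln 2)%R.
  have : (INR n < 2 ^ (6 * 2 ^ k))%R.
    by have := lt_INR _ _ (elimT ltP nK); rewrite INR_expn.
  move/(ln_increasing _ _ nR0); rewrite ln_pow; last by lra.
  by rewrite mult_INR (_ : INR 6 = 6%R) ?INR_IZR_INZ //; lra.
move: (INR (2 ^ k)) Kpos lognK => K Kpos lognK.
rewrite /shannon_bound /log2.
have : (0 < 2 ^ n)%R by apply: pow_lt; lra.
move: (2 ^ n)%R => M M0 LM.
have -> : (192 * INR n * M / (ln (INR n) / ln 2) = 192 * INR n * M * ln 2 / ln (INR n))%R.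
  by field; lra.
have nM : (0 < INR n * M)%R by apply: Rmult_lt_0_compat; lra.
have B0 : (0 < 192 * INR n * M * ln 2 / ln (INR n))%R.
  by apply: Rdiv_lt_0_compat => //; nra.
apply: (Rle_trans _ (192 * INR n * M * ln 2 / ln (INR n))); last by nra.
apply: (Rmult_le_reg_r (ln (INR n))) => //.
have -> : (192 * INR n * M * ln 2 / ln (INR n) * ln (INR n) = 192 * (INR n * M * ln 2))%R.
  by field; lra.
have [L0|L0] := Rle_or_lt L 0; first by nra.
(* With [log2 n <= 6 * K] and [L * K <= 27 * n * 2 ^ n], the constant obtained is [6 * 27 = 162],
   below 192. *)
apply: (Rle_trans _ (L * (6 * K * ln 2))); first by apply: Rmult_le_compat_l; lra.
have : (L * K * ln 2 <= 27 * INR n * M * ln 2)%R by apply: Rmult_le_compat_r; lra.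
have : (0 < INR n * M * ln 2)%R by apply: Rmult_lt_0_compat.
by lra.
Qed.
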